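(* Let $d\geq 1$ be an odd integer which is neither a prime nor the product of two distinct primes. Then $M_{odd}(d)\leq 2$ if and only if $d\in\{1, 9, 25, 27, 49, 63, 135, 175, 207, 343\}$.
   Context: For an integer $n\geq 2$, $\omega(n)$ denotes the number of distinct prime divisors of $n$. For an integer $d\geq 1$, $M_{odd}(d):=\max\{\omega(d+x^2) : x \text{ an odd integer with } 1\leq x\leq\sqrt d\}$. *)

(* Defs.v *)
From mathcomp Require Import all_boot.

Set Implicit Arguments.
Unset Strict Implicit.
Unset Printing Implicit Defensive.

Definition omega (n : nat) : nat := size (primes n).

(* The condition x <= sqrt d is written x ^ 2 <= d; it forces x <= d, so the
   upper bound of the index range excludes no admissible x.  For d >= 1 the
   index x = 1 is admissible, so the maximum is never the default value 0 of
   an empty range. *)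
Definition M_odd (d : nat) : nat :=
  \max_(1 <= x < d.+1 | odd x && (x ^ 2 <= d)) omega (d + x ^ 2).

(* Main.v *)
Require Import Defs.
From mathcomp Require Import all_boot.
From mathcomp Require Import zify.

(** Call [d] admissible when [omega (d + x ^ 2) <= 2] for every odd [x] with
    [x ^ 2 <= d]; this is [M_odd d <= 2].  For odd [d] and odd [x] the number
    [d + x ^ 2] is even, so one odd prime at most is left for its odd part.
    Hence, if [x] is chosen so that [d + x ^ 2 = m * k] with [m > 1] odd and
    prime to [k], then [k] is a power of 2 ([pow2_cofactor]).  Applied to
    several [x] sharing a factor with [d], this gives several powers of 2
    whose differences are known, and such coincidences are rare.

    A coprime factorization [d = m * e] into factors greater than 1 gives
    [m + e = 2 ^ i] from [x = minn m e], and [x = m], [x = 3 * m] together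
    give [e < 9 * m], because the smaller of two powers of 2 that differ by
    [8 * m], [m] odd, is at most 8 ([pow2_gap]).

    - Three distinct primes.  Write [d = P * Q * R] with pairwise coprime
      factors.  Both [Q * R + P] and [P * R + Q] are powers of 2, and their
      sum and difference factor as [(Q + P) * (R + 1)] and [(Q - P) * (R - 1)],
      which do not contain enough factors 2.
    - Two primes, [d = p ^ a * q ^ b] with [q ^ b < p ^ a].  If [a >= 3], then
      [x = p] makes [p ^ (a - 2) * q ^ b + 1] a power of 2, and comparison with
      [p ^ a + q ^ b] forces [q ^ b <= 2 * p] ([power_pair_bound]).  The same
      with [p] and [q] exchanged forces [b <= 2].  What survives is [d = 135]
      and [d] equal to a prime times the square of another one, [p * q ^ 2].
      There [x = q * y] makes [p + y ^ 2] a power of 2 whenever [q] does not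
      divide it; with [y = 1, 3, 5] only small [p] and [q] remain.
    - One prime.  For [d = p ^ a], [a >= 3], the choices [x = p * y] with
      [y = 1, 3, 5] again give powers of 2 too close to each other unless [d]
      is small.  For [d = p ^ 2] the sums [p ^ 2 + x ^ 2] are twice an odd
      number; for [p >= 11] two values of [x <= 9] make this a multiple of 5,
      thus twice a power of 5, and two powers of 5 would differ by 20 or 40. *)

Set Implicit Arguments.
Unset Strict Implicit.
Unset Printing Implicit Defensive.

(** * Admissible numbers *)

Definition admissible (d : nat) : Prop :=
  forall x, odd x -> x ^ 2 <= d -> omega (d + x ^ 2) <= 2.

Lemma M_odd_le2P (d : nat) : M_odd d <= 2 <-> admissible d.
Proof.
rewrite /M_odd; split=> [le2 x odd_x le_xd | adm].
  apply: leq_trans le2.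
  apply: (@leq_bigmax_seq _ _ (fun x => odd x && (x ^ 2 <= d))
            (fun x => omega (d + x ^ 2))); last by rewrite odd_x.
  rewrite mem_index_iota; nia.
apply/bigmax_leqP_seq => x _ /andP[odd_x le_xd]; exact: adm.
Qed.

(** A computable form of admissibility; the explicit bound [n] on [x] keeps the
    unary evaluation small. *)
Definition admissible_below (n d : nat) : bool :=
  all (fun x => odd x && (x ^ 2 <= d) ==> (omega (d + x ^ 2) <= 2)) (iota 0 n).

Lemma admissible_belowW (n d : nat) : admissible d -> admissible_below n d.
Proof.
by move=> adm; apply/allP => x _; apply/implyP => /andP[odd_x]; apply: adm.
Qed.

Lemma admissible_belowP (n d : nat) :
  d < n ^ 2 -> admissible_below n d -> admissible d.
Proof.
move=> lt_dn /allP adm x odd_x le_xd.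
have x_iota : x \in iota 0 n.
  by rewrite mem_iota -(ltn_exp2r _ _ (isT : 0 < 2)) (leq_ltn_trans le_xd).
by have := adm x x_iota; rewrite odd_x le_xd.
Qed.

Definition exceptions : seq nat := [:: 1; 9; 25; 27; 49; 63; 135; 175; 207; 343].

Lemma exceptions_admissible (d : nat) : d \in exceptions -> admissible d.
Proof.
have check : all (fun d => (d < 19 ^ 2) && admissible_below 19 d) exceptions.
  by vm_compute.
by move/(allP check) => /andP[]; apply: admissible_belowP.
Qed.

(** * Powers of 2 *)

(** If [s < i], then [2 ^ s.+1] would divide both powers of 2, hence their
    difference [2 ^ s * m]. *)
Lemma pow2_gap (i j s m : nat) : odd m -> 2 ^ i + 2 ^ s * m = 2 ^ j -> i <= s.
Proof.
move=> odd_m E; rewrite leqNgt; apply/negP => lt_si.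
have lt_ij : i < j.
  rewrite -(ltn_exp2l i j (isT : 1 < 2)) -E -addn1 leq_add2l muln_gt0 expn_gt0.
  exact: odd_gt0.
have : 2 ^ s.+1 %| 2 ^ s * m.
  rewrite -(dvdn_addr _ (dvdn_exp2l 2 lt_si)) E.
  by apply: dvdn_exp2l; apply: ltn_trans lt_ij.
by rewrite expnSr dvdn_pmul2l ?expn_gt0 // dvdn2 odd_m.
Qed.

(** The factor [a] absorbs at most one factor 2. *)
Lemma pow2_dvd_half (n a b : nat) : 2 ^ n.+1 %| a * b -> ~~ (4 %| a) -> 2 ^ n %| b.
Proof.
move=> dvd_ab n4a; case odd_a: (odd a).
  rewrite Gauss_dvdr in dvd_ab; last by rewrite coprimeXl // coprime2n.
  by apply: dvdn_trans dvd_ab; apply: dvdn_exp2l.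
have [c ac] : exists c, a = c * 2 by apply/dvdnP; rewrite dvdn2 odd_a.
have odd_c : odd c by apply: contraNT n4a; rewrite ac -dvdn2 => /(dvdn_mul (dvdnn 2)); rewrite mulnC.
move: dvd_ab; rewrite ac expnS -mulnA mulnCA dvdn_pmul2l //.
by rewrite Gauss_dvdr // coprimeXl // coprime2n.
Qed.

(** * Cofactors that are powers of 2 *)

Lemma omega_le2_prime (n p r : nat) :
  omega n <= 2 -> 0 < n -> ~~ odd n -> prime p -> odd p -> p %| n ->
  prime r -> r %| n -> r = 2 \/ r = p.
Proof.
move=> w2 n0 ev pp op pn rp rn.
case: (eqVneq r 2) => [|r2]; first by left.
case: (eqVneq r p) => [|r_p]; first by right.
have p2 : p != 2 by apply: contraTneq op => ->.
have : size [:: r; p; 2] <= size (primes n).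
  apply: uniq_leq_size; first by rewrite /= !inE negb_or r2 r_p p2.
  move=> x; rewrite !inE mem_primes n0 => /or3P[] /eqP -> //=; rewrite ?rp ?pp //.
  by rewrite dvdn2.
by rewrite /omega in w2; rewrite leqNgt ltnS w2.
Qed.

(** The prime 2 and an odd prime divisor of [m] already exhaust the two prime
    divisors allowed, so the primes of [k] can only be 2. *)
Lemma pow2_cofactor (d x m k : nat) :
  admissible d -> odd d -> odd x -> x ^ 2 <= d -> d + x ^ 2 = m * k ->
  1 < m -> odd m -> coprime m k -> exists e, k = 2 ^ e.
Proof.
move=> adm od ox le_xd E m1 om co.
have mk0 : 0 < m * k by rewrite -E addn_gt0 odd_gt0.
have k0 : 0 < k by move: mk0; rewrite muln_gt0 => /andP[].
have pp := pdiv_prime m1; have pm := pdiv_dvd m.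
have op := dvdn_odd pm om.
have ev : ~~ odd (m * k) by rewrite -E oddD oddX od ox.
have w2 := adm x ox le_xd; rewrite E in w2.
have pn : 2.-nat k.
  apply/pnatP => // r rp rk; rewrite inE /=.
  case: (omega_le2_prime w2 mk0 ev pp op (dvdn_mulr _ pm) rp (dvdn_mull _ rk)) => [-> //|rE].
  have : r %| gcdn m k by rewrite dvdn_gcd rk rE pm.
  by rewrite (eqP co) dvdn1 => /eqP r1; rewrite r1 in rp.
by case/p_natP: pn => e ->; exists e.
Qed.

(** Take [x = m * y], so that [d + x ^ 2 = m * (e + m * y ^ 2)]. *)
Lemma coprime_split_pow2 (d m e y : nat) :
  admissible d -> odd d -> d = m * e -> coprime m e -> 1 < m -> odd y ->
  m * y ^ 2 <= e -> exists i, e + m * y ^ 2 = 2 ^ i.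
Proof.
move=> adm od dE co m1 oy le_e.
have om : odd m by move: od; rewrite dE oddM => /andP[].
apply: (@pow2_cofactor d (m * y) m) => //.
- by rewrite oddM om.
- by rewrite dE expnMn -mulnn -mulnA leq_pmul2l // ltnW.
- by rewrite dE expnMn -mulnn -mulnA -mulnDr.
- by rewrite /coprime addnC mulnC gcdnMDl.
Qed.

Lemma coprime_split_sum (d m e : nat) :
  admissible d -> odd d -> d = m * e -> coprime m e -> 1 < m -> 1 < e ->
  exists i, m + e = 2 ^ i.
Proof.
move=> adm od dE co m1 e1; case: (leqP m e) => [le|/ltnW le].
  case: (@coprime_split_pow2 d m e 1) => //; first by rewrite muln1.
  by move=> i; rewrite muln1 addnC; exists i.
case: (@coprime_split_pow2 d e m 1) => //; rewrite ?muln1 1?coprime_sym //.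
  by rewrite mulnC.
by move=> i; exists i.
Qed.

(** Otherwise [e + m] and [e + 9 * m] are both powers of 2, which differ by
    [8 * m]; then [e + m <= 8] by [pow2_gap], contradicting [9 * m <= e]. *)
Lemma coprime_split_ratio (d m e : nat) :
  admissible d -> odd d -> d = m * e -> coprime m e -> 1 < m -> e < 9 * m.
Proof.
move=> adm od dE co m1; rewrite ltnNge; apply/negP => le.
have om : odd m by move: od; rewrite dE oddM => /andP[].
case: (@coprime_split_pow2 d m e 1) => // [|i Ei]; first by lia.
case: (@coprime_split_pow2 d m e 3) => // [|j Ej]; first by lia.
have i3 : i <= 3 by apply: (@pow2_gap i j 3 m) => //; rewrite -Ei -Ej; lia.
have : 2 ^ i <= 2 ^ 3 by rewrite leq_exp2l.
rewrite -Ei; lia.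
Qed.

(** The sum of [v - u] and [v + u] is twice an odd number. *)
Lemma odd_not_dvd4 (u v : nat) : odd u -> odd v -> u <= v ->
  ~~ (4 %| v - u) \/ ~~ (4 %| v + u).
Proof. lia. Qed.

(** * At least three prime divisors *)

(** The smaller power [2 ^ b] divides the sum [(Q + P) * (R + 1)] and the
    difference [(Q - P) * (R - 1)] of the two powers.  As [Q - P] or [Q + P] is
    not a multiple of 4, half of [2 ^ b] divides [R + 1] or [R - 1]; but
    [2 ^ b = P * R + Q] is larger than [2 * (R + 1)]. *)
Lemma three_factor_sums_not_pow2 (P Q R a b : nat) : odd P -> odd Q -> odd R ->
  1 < P -> P < Q -> 1 < R -> Q * R + P = 2 ^ a -> P * R + Q = 2 ^ b -> False.
Proof.
move=> oP oQ oR P1 PQ R1 Ea Eb.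
have diff : (Q * R + P) = (P * R + Q) + (Q - P) * (R - 1).
  by rewrite -{1 2}(subnK (ltnW PQ)) -{1 2}(subnK (ltnW R1)); lia.
have dvd_ab : 2 ^ b %| 2 ^ a.
  by apply: dvdn_exp2l; rewrite -(leq_exp2l _ _ (isT : 1 < 2)) -Ea -Eb diff leq_addr.
have dD : 2 ^ b %| (Q + P) * (R + 1).
  have -> : (Q + P) * (R + 1) = (Q * R + P) + (P * R + Q) by clear; lia.
  by rewrite Ea Eb dvdn_addl.
have dB : 2 ^ b %| (Q - P) * (R - 1).
  by rewrite -(dvdn_addr _ (dvdnn (2 ^ b))) -{2}Eb -diff Ea.
have R3 : 3 * R <= P * R by rewrite leq_pmul2r; lia.
case: b Eb dD dB {dvd_ab diff} => [|n] Eb dD dB; first by rewrite expn0 in Eb; lia.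
rewrite expnS in Eb.
case: (odd_not_dvd4 oP oQ (ltnW PQ)) => n4.
  have /dvdn_leq := pow2_dvd_half dB n4; lia.
have /dvdn_leq := pow2_dvd_half dD n4; lia.
Qed.

(** [coprime_split_sum] for the splittings [p ^ a * (q ^ b * r)] and
    [q ^ b * (p ^ a * r)] contradicts [three_factor_sums_not_pow2]. *)
Lemma three_prime_factors_not_admissible (p q a b r : nat) : prime p -> prime q -> p != q ->
  0 < a -> 0 < b -> 1 < r -> coprime p r -> coprime q r ->
  odd (p ^ a * q ^ b * r) -> admissible (p ^ a * q ^ b * r) -> False.
Proof.
move=> pp pq neq a0 b0 r1 copr coqr od adm.
have P1 : 1 < p ^ a by rewrite -(expn0 p) ltn_exp2l ?prime_gt1.
have Q1 : 1 < q ^ b by rewrite -(expn0 q) ltn_exp2l ?prime_gt1.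
have coPQ : coprime (p ^ a) (q ^ b).
  by rewrite coprimeXl // coprimeXr // prime_coprime // dvdn_prime2.
have coPr : coprime (p ^ a) r by rewrite coprimeXl.
have coQr : coprime (q ^ b) r by rewrite coprimeXl.
have [oP oQ oR] : [/\ odd (p ^ a), odd (q ^ b) & odd r].
  by move: od; rewrite !oddM => /andP[/andP[-> ->] ->].
have [||||i Ei] := @coprime_split_sum _ (p ^ a) (q ^ b * r) adm od.
- by rewrite mulnA.
- by rewrite coprimeMr coPQ.
- by [].
- by rewrite (leq_trans Q1) // leq_pmulr // ltnW.
have [||||j Ej] := @coprime_split_sum _ (q ^ b) (p ^ a * r) adm od.
- by rewrite mulnCA mulnA.
- by rewrite coprimeMr coprime_sym coPQ.
- by [].
- by rewrite (leq_trans P1) // leq_pmulr // ltnW.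
have [lt|lt|eqPQ] := ltngtP (p ^ a) (q ^ b).
- by apply: (@three_factor_sums_not_pow2 (p ^ a) (q ^ b) r i j) => //; rewrite addnC.
- by apply: (@three_factor_sums_not_pow2 (q ^ b) (p ^ a) r j i) => //; rewrite addnC.
by move: coPQ; rewrite eqPQ /coprime gcdnn; lia.
Qed.

(** * Two prime divisors *)

(** The smaller of the two powers divides
    [A * (A * p ^ 2 + Q) - (A * Q + 1) = (p * A - 1) * (p * A + 1)], and one of
    these factors is not a multiple of 4, so the smaller power is at most [2 * (p * A + 1)].
    This is too small for [A * p ^ 2 + Q], hence it bounds [A * Q + 1]. *)
Lemma power_pair_bound (p A Q k l : nat) : odd p -> 1 < p -> odd A -> 1 < A ->
  A * Q + 1 = 2 ^ k -> A * p ^ 2 + Q = 2 ^ l -> Q <= 2 * p.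
Proof.
move=> op p1 oA A1 Ek El.
have opA : odd (p * A) by rewrite oddM op.
have pA3 : 3 * A <= p * A by rewrite leq_pmul2r; lia.
have dvd n : n <= k -> n <= l -> 2 ^ n <= 2 * (p * A + 1).
  case: n => [|n] nk nl; first by rewrite expn0; lia.
  have d0 : 2 ^ n.+1 %| (p * A - 1) * (p * A + 1).
    have E : (p * A - 1) * (p * A + 1) + 2 ^ k = A * 2 ^ l.
      by rewrite -Ek -El -subn_sqr exp1n expnMn; move: pA3 A1; clear; nia.
    by rewrite -(dvdn_addl _ (dvdn_exp2l 2 nk)) E dvdn_mull // dvdn_exp2l.
  rewrite expnS leq_pmul2l //.
  have pA1 : 1 < p * A by lia.
  case: (@odd_not_dvd4 1 (p * A) isT opA (ltnW pA1)) => n4.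
    have /dvdn_leq := pow2_dvd_half d0 n4; lia.
  rewrite mulnC in d0.
  have /dvdn_leq := pow2_dvd_half d0 n4; lia.
case: (leqP k l) => [kl|/ltnW lk].
  have := dvd _ (leqnn k) kl; rewrite -Ek; move: A1; clear; nia.
have := dvd _ lk (leqnn l); rewrite -El expnS expn1.
have : 3 * (p * A) <= A * (p * p).
  by rewrite [A * _]mulnC -mulnA leq_mul //; lia.
by move: pA3 A1; clear; lia.
Qed.

(** The bound 22 on [x] is the smallest that rejects all the non-exceptional
    numbers met in the searches below. *)
Definition prime_cofactor_check (q n : nat) : bool :=
  all (fun p => [&& odd p, prime p & admissible_below 22 (p * q ^ 2)] ==>
                (p * q ^ 2 \in exceptions)) (iota 0 n).

Lemma small_prime_cofactor (q n p : nat) :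
  prime_cofactor_check q n -> p < n -> odd p -> prime p ->
  admissible (p * q ^ 2) -> p * q ^ 2 \in exceptions.
Proof.
move=> /allP check lt_pn op pp adm.
have := check p; rewrite mem_iota lt_pn op pp /= => /(_ isT) /implyP; apply.
exact: admissible_belowW.
Qed.

(** For [p >= 25] and [q >= 7] the prime [q] divides at most one of [p + 1],
    [p + 9], [p + 25], since their differences are 8, 16 and 24.  The two others
    are powers of 2 with one of these differences, so the smaller one is at most
    16.  The remaining cases are finite: [q < 15] follows from
    [q ^ 2 < 9 * p] when [p < 25], and [p < 9 * q ^ 2] when [q] is 3 or 5. *)
Lemma admissible_prime_mul_square (p q : nat) : prime p -> prime q -> odd p -> odd q ->
  p != q -> admissible (p * q ^ 2) -> p * q ^ 2 \in exceptions.
Proof.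
move=> pp pq op oq neq adm.
have p1 := prime_gt1 pp; have q1 := prime_gt1 pq.
have od : odd (p * q ^ 2) by rewrite oddM op oddX oq orbT.
have co : coprime p (q ^ 2) by rewrite coprimeXr // prime_coprime // dvdn_prime2.
have q2 : 1 < q ^ 2 by rewrite -(exp1n 2) ltn_exp2r.
have ub_p : p < 9 * q ^ 2.
  by apply: (coprime_split_ratio adm od _ _ q2); rewrite 1?mulnC 1?coprime_sym.
have ub_q : q ^ 2 < 9 * p by apply: (coprime_split_ratio adm od erefl co p1).
(* Choose x = q * y and divide d + x ^ 2 by q ^ 2. *)
have shift y : odd y -> y ^ 2 <= p -> ~~ (q %| p + y ^ 2) ->
    exists i, p + y ^ 2 = 2 ^ i.
  move=> oy le_yp ndvd.
  apply: (@pow2_cofactor (p * q ^ 2) (q * y) (q ^ 2)) => //.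
  - by rewrite oddM oq.
  - by rewrite expnMn mulnC leq_mul2r le_yp orbT.
  - by rewrite expnMn mulnDr [p * _]mulnC.
  - by rewrite oddX oq orbT.
  - by rewrite coprimeXl // prime_coprime.
have [p25|p25] := ltnP p 25.
  have q15 : q < 15 by rewrite -(ltn_exp2r _ _ (isT : 0 < 2)); lia.
  have check : all (fun q => odd q && prime q ==> prime_cofactor_check q 25) (iota 0 15).
    by vm_compute.
  have := allP check q; rewrite mem_iota q15 oq pq => /(_ isT) /= chk.
  exact: small_prime_cofactor chk p25 op pp adm.
have [q3|nq3] := eqVneq q 3.
  apply: (@small_prime_cofactor q 81) => //; last by rewrite q3 in ub_p.
  by rewrite q3; vm_compute.
have [q5|nq5] := eqVneq q 5.
  apply: (@small_prime_cofactor q 225) => //; last by rewrite q5 in ub_p.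
  by rewrite q5; vm_compute.
have n8 : ~~ (q %| 8).
  by rewrite -[8]/(2 ^ 3) Euclid_dvdX // dvdn_prime2 // andbT; apply: contraTneq oq => ->.
have n24 : ~~ (q %| 24).
  by rewrite -[24]/(3 * 8) Euclid_dvdM // negb_or n8 dvdn_prime2 // nq3.
have n16 : ~~ (q %| 16).
  by rewrite -[16]/(2 ^ 4) Euclid_dvdX // dvdn_prime2 // andbT; apply: contraTneq oq => ->.
(* If q divided neither sum, both would be powers of 2 differing by 2 ^ s * m. *)
have gap y z s m : odd y -> odd z -> y ^ 2 <= 25 -> z ^ 2 <= 25 ->
    z ^ 2 = y ^ 2 + 2 ^ s * m -> odd m -> 2 ^ s <= 16 ->
    (q %| p + y ^ 2) || (q %| p + z ^ 2).
  move=> oy oz ley lez E om s16; apply: contraT; rewrite negb_or => /andP[ny nz].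
  have [i Ei] := shift y oy (leq_trans ley p25) ny.
  have [j Ej] := shift z oz (leq_trans lez p25) nz.
  have : 2 ^ i <= 2 ^ s.
    by rewrite leq_exp2l //; apply: (@pow2_gap i j s m om); rewrite -Ei -Ej E addnA.
  rewrite -Ei => /leq_trans /(_ s16) /(leq_trans (leq_addr _ _)).
  by move/(leq_trans p25).
have := @gap 1 3 3 1 isT isT isT isT erefl isT isT.
have := @gap 1 5 3 3 isT isT isT isT erefl isT isT.
have := @gap 3 5 4 1 isT isT isT isT erefl isT isT.
have d1 : (q %| p + 3 ^ 2) -> (q %| p + 1 ^ 2) = false.
  move=> d3; apply: contraNF n8 => d1.
  have : q %| (p + 3 ^ 2) - (p + 1 ^ 2) by apply: dvdn_sub.
  by rewrite subnDl.
have d2 : (q %| p + 5 ^ 2) -> (q %| p + 1 ^ 2) = false.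
  move=> d3; apply: contraNF n24 => d1'.
  have : q %| (p + 5 ^ 2) - (p + 1 ^ 2) by apply: dvdn_sub.
  by rewrite subnDl.
have d3 : (q %| p + 5 ^ 2) -> (q %| p + 3 ^ 2) = false.
  move=> d5; apply: contraNF n16 => d3'.
  have : q %| (p + 5 ^ 2) - (p + 3 ^ 2) by apply: dvdn_sub.
  by rewrite subnDl.
by case: (q %| p + 5 ^ 2) d2 d3 => [/(_ isT) -> /(_ isT) -> //|_ _];
  case: (q %| p + 3 ^ 2) d1 => [/(_ isT) ->|].
Qed.

Lemma odd_sqr_mod4 (n : nat) : odd n -> n ^ 2 %% 4 = 1.
Proof. by move=> on; rewrite -modnXm; have [->|->] : n %% 4 = 1 \/ n %% 4 = 3 by lia. Qed.

Lemma admissible_two_prime_powers (p q a b : nat) : prime p -> prime q -> odd p -> odd q ->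
  p != q -> 0 < a -> 0 < b -> ~~ ((a == 1) && (b == 1)) ->
  q ^ b < p ^ a -> admissible (p ^ a * q ^ b) -> p ^ a * q ^ b \in exceptions.
Proof.
move=> pp pq op oq neq a0 b0 nab lt adm.
have p1 := prime_gt1 pp; have q1 := prime_gt1 pq.
have oP : odd (p ^ a) by rewrite oddX op orbT.
have oQ : odd (q ^ b) by rewrite oddX oq orbT.
have od : odd (p ^ a * q ^ b) by rewrite oddM oP.
have copq : coprime p q by rewrite prime_coprime // dvdn_prime2.
have co : coprime (p ^ a) (q ^ b) by rewrite coprimeXl // coprimeXr.
have P1 : 1 < p ^ a by rewrite -(expn0 p) ltn_exp2l.
have Q1 : 1 < q ^ b by rewrite -(expn0 q) ltn_exp2l.
have ub : p ^ a < 9 * q ^ b.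
  by apply: (coprime_split_ratio adm od _ _ Q1); rewrite 1?mulnC 1?coprime_sym.
(* With x = r, both r ^ c.+1 * s ^ e + 1 and r ^ c.+3 + s ^ e are powers
   of 2; the statement is symmetric so that it applies to p and to q. *)
have bound r s c e : prime r -> odd r -> odd s -> coprime r s -> 1 < s ->
    r ^ c.+3 * s ^ e = p ^ a * q ^ b -> s ^ e <= 2 * r.
  move=> pr or os cors s1 E.
  have r1 := prime_gt1 pr.
  have A1 : 1 < r ^ c.+1 by rewrite -(expn0 r) ltn_exp2l.
  have Er : r ^ c.+3 = r ^ c.+1 * r ^ 2 by rewrite -expnD addn2.
  have [->|e0] := posnP e; first by rewrite expn0; lia.
  have S1 : 1 < s ^ e by rewrite -(expn0 s) ltn_exp2l.
  have [k Ek] : exists k, r ^ c.+1 * s ^ e + 1 = 2 ^ k.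
    apply: (@pow2_cofactor (p ^ a * q ^ b) r (r ^ 2)) => //.
    - by rewrite -E Er mulnAC leq_pmull // muln_gt0 !expn_gt0 !(ltnW r1) ltnW.
    - by rewrite -E Er mulnDr muln1 mulnAC mulnC.
    - by rewrite -(exp1n 2) ltn_exp2r.
    - by rewrite oddX or orbT.
    - by rewrite coprimeXl // expnS -mulnA /coprime [r * _]mulnC gcdnMDl gcdn1.
  have [|||n En] := @coprime_split_sum _ (r ^ c.+3) (s ^ e) adm od (esym E).
  - by rewrite coprimeXl // coprimeXr.
  - by rewrite -(expn0 r) ltn_exp2l.
  - by [].
  apply: (@power_pair_bound r (r ^ c.+1) (s ^ e) k n) => //.
    by rewrite oddX or orbT.
  by rewrite -Er.
(* If b >= 3, then q ^ b < p ^ a <= 2 * q. *)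
have b2 : b <= 2.
  rewrite leqNgt; apply/negP => b3.
  have bE : b = (b - 3).+3 by lia.
  have : p ^ a <= 2 * q.
    by apply: (@bound q p (b - 3)) => //; rewrite 1?coprime_sym // -bE mulnC.
  have : q ^ 3 <= q ^ b by rewrite leq_exp2l.
  have : 3 * q <= q * q by rewrite leq_mul2r; lia.
  have : 1 * (q * q) <= q * (q * q) by rewrite leq_mul2r; lia.
  rewrite -[q ^ 3]/(q * (q * q)); lia.
have [a3|a2] := ltnP 2 a.
  have aE : a = (a - 3).+3 by lia.
  have Q2p : q ^ b <= 2 * p by apply: (@bound p q (a - 3)) => //; rewrite -aE.
  (* Here p ^ 3 <= p ^ a < 9 * q ^ b <= 18 * p, so p ^ 2 < 18. *)
  have p3 : p = 3.
    have : p ^ 3 <= p ^ a by rewrite leq_exp2l.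
    rewrite -[p ^ 3]/(p * (p * p)) => ub3.
    have : p * (p * p) < p * 18 by lia.
    rewrite ltn_pmul2l ?prime_gt0 // => pp18.
    have : p < 5 by rewrite -(ltn_exp2r _ _ (isT : 0 < 2)) (leq_trans pp18).
    move: op p1; clear; lia.
  subst p.
  have Ea : a = 3.
    have : 3 ^ a < 3 ^ 4 by lia.
    by rewrite ltn_exp2l //; lia.
  have q4 : q <= 6 by apply: leq_trans Q2p; rewrite -{1}(expn1 q) leq_exp2l.
  have q5 : q = 5 by move: q4 oq q1 neq; clear; lia.
  have b1 : b = 1.
    have : 5 ^ b < 5 ^ 2 by move: Q2p; rewrite q5; lia.
    by rewrite ltn_exp2l //; lia.
  by rewrite Ea q5 b1.
have [[a1 b1]|[[a1 b1]|[a1 b1]]] :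
    (a = 1 /\ b = 2) \/ (a = 2 /\ b = 1) \/ (a = 2 /\ b = 2) by lia.
- by rewrite a1 b1 expn1 in adm *; apply: admissible_prime_mul_square.
- rewrite a1 b1 expn1 mulnC in adm *.
  by apply: admissible_prime_mul_square => //; rewrite eq_sym.
(* A sum of two odd squares is 2 modulo 4. *)
have [l El] := coprime_split_sum adm od erefl co P1 Q1.
exfalso; move: El P1 Q1; rewrite a1 b1.
case: l => [|[|l]]; rewrite ?expn0 ?expn1; [lia|lia|].
have := odd_sqr_mod4 op; have := odd_sqr_mod4 oq.
rewrite !expnS; lia.
Qed.

(** * Prime powers *)

(** A sum of two odd squares contains the factor 2 exactly once, and 5 uses up
    the other prime divisor allowed. *)
Lemma sum_squares_twice_pow5 (p x : nat) : admissible (p ^ 2) -> odd p -> odd x ->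
  x <= p -> 5 %| p ^ 2 + x ^ 2 -> exists j, p ^ 2 + x ^ 2 = 2 * 5 ^ j.
Proof.
move=> adm op ox le_xp dvd5.
have n0 : 0 < p ^ 2 + x ^ 2 by rewrite addn_gt0 expn_gt0 odd_gt0.
have w2 : omega (p ^ 2 + x ^ 2) <= 2 by apply: adm => //; rewrite leq_exp2r.
have [k kE ok] : exists2 k, p ^ 2 + x ^ 2 = 2 * k & odd k.
  have := odd_sqr_mod4 op; have := odd_sqr_mod4 ox.
  by exists ((p ^ 2 + x ^ 2) %/ 2); lia.
rewrite kE in n0 w2 dvd5 *.
have ev : ~~ odd (2 * k) by rewrite mul2n odd_double.
have n5 : 5.-nat k.
  apply/pnatP => [|r rp rk]; first exact: odd_gt0.
  have [r2|->//] := omega_le2_prime w2 n0 ev (isT : prime 5) isT dvd5 rp (dvdn_mull 2 rk).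
  by move: rk; rewrite r2 dvdn2 ok.
by case/p_natP: n5 => j ->; exists j.
Qed.

Lemma pow5_gap (i j c : nat) : 0 < c -> ~~ (25 %| c) -> 5 ^ i + c = 5 ^ j -> i <= 1.
Proof.
move=> c0 n25 E; rewrite leqNgt; apply/negP => i2.
have lt_ij : i < j by rewrite -(ltn_exp2l i j (isT : 1 < 5)) -E -[X in X < _]addn0 ltn_add2l.
case/negP: n25; rewrite -(dvdn_addr _ (dvdn_exp2l 5 i2)) E.
exact/(dvdn_exp2l 5)/(leq_trans i2)/ltnW.
Qed.

(** For [p >= 11], squares modulo 5 show that 5 divides [p ^ 2 + x ^ 2] either for
    [x = 3, 7] or for [x = 1, 9].  Half of these two sums are powers of 5 that
    differ by 20 or 40, so the smaller one is at most 5 by [pow5_gap]. *)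
Lemma admissible_prime_square (p : nat) : prime p -> odd p -> admissible (p ^ 2) ->
  p ^ 2 \in exceptions.
Proof.
move=> pp op adm; have p1 := prime_gt1 pp.
have [p11|p11] := ltnP p 11.
  have [->|[->|[->|p9]]] // : p = 3 \/ p = 5 \/ p = 7 \/ p = 9 by move: op p1 p11; clear; lia.
  by rewrite p9 in pp.
exfalso.
have pair x y c : odd x -> odd y -> x <= 10 -> y <= 10 -> 0 < c -> ~~ (25 %| c) ->
    y ^ 2 = x ^ 2 + 2 * c -> 5 %| p ^ 2 + x ^ 2 -> 5 %| p ^ 2 + y ^ 2 -> False.
  move=> ox oy lex ley c0 n25 E dx dy.
  have [i Ei] := sum_squares_twice_pow5 adm op ox (leq_trans lex (ltnW p11)) dx.
  have [j Ej] := sum_squares_twice_pow5 adm op oy (leq_trans ley (ltnW p11)) dy.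
  have i1 : i <= 1.
    apply: (@pow5_gap i j c c0 n25); apply/eqP.
    by rewrite -(eqn_pmul2l (isT : 0 < 2)) mulnDr -Ei -Ej E addnA.
  have : 5 ^ i <= 5 ^ 1 by rewrite leq_exp2l.
  have : 11 ^ 2 <= p ^ 2 by rewrite leq_exp2r.
  by move: Ei; clear; lia.
have p5 : p %% 5 != 0.
  by apply/negP; rewrite -/(5 %| p) dvdn_prime2 // => /eqP p5; rewrite -p5 in p11.
have dvd5 x : (5 %| p ^ 2 + x ^ 2) = (((p %% 5) ^ 2 + x ^ 2) %% 5 == 0).
  by rewrite /dvdn -modnDml -modnXm modnDml.
have [p14|p23] : (p %% 5 = 1 \/ p %% 5 = 4) \/ (p %% 5 = 2 \/ p %% 5 = 3).
  by move: p5; clear; lia.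
- by apply: (@pair 3 7 20) => //; rewrite dvd5; case: p14 => ->.
- by apply: (@pair 1 9 40) => //; rewrite dvd5; case: p23 => ->.
Qed.

(** For [a >= 3], [x = p * y] makes [p ^ (a - 2) + y ^ 2] a power of 2 when [p] does
    not divide [y].  Comparing [y = 1] with [y = 3], or with [y = 5] if [p = 3],
    gives [p ^ (a - 2) < 9], or [3 ^ (a - 2) < 25]. *)
Lemma admissible_prime_power (p a : nat) : prime p -> odd p -> 1 < a -> admissible (p ^ a) ->
  p ^ a \in exceptions.
Proof.
move=> pp op a1 adm; have p1 := prime_gt1 pp.
case: a a1 adm => [|[|[|c]]] // _ adm; first exact: admissible_prime_square.
have Ep : p ^ c.+3 = p ^ 2 * p ^ c.+1 by rewrite -expnD add2n.
have shift y : odd y -> coprime p y -> y ^ 2 <= p ^ c.+1 ->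
    exists i, p ^ c.+1 + y ^ 2 = 2 ^ i.
  move=> oy copy le_y.
  apply: (@pow2_cofactor (p ^ c.+3) (p * y) (p ^ 2)) => //.
  - by rewrite oddX op orbT.
  - by rewrite oddM op.
  - by rewrite expnMn Ep leq_mul2l le_y orbT.
  - by rewrite expnMn Ep mulnDr.
  - by rewrite -(exp1n 2) ltn_exp2r.
  - by rewrite oddX op orbT.
  - by rewrite coprimeXl // expnS /coprime [p * _]mulnC gcdnMDl -/(coprime _ _) coprimeXr.
have [|||i Ei] := shift 1; rewrite ?coprimen1 // ?expn_gt0 ?prime_gt0 //.
have gap y m : odd y -> coprime p y -> y ^ 2 = 1 ^ 2 + 2 ^ 3 * m -> odd m ->
    p ^ c.+1 < y ^ 2.
  move=> oy copy Ey om; rewrite ltnNge; apply/negP => le_y.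
  have [j Ej] := shift y oy copy le_y.
  have : 2 ^ i <= 2 ^ 3.
    by rewrite leq_exp2l //; apply: (@pow2_gap i j 3 m om); rewrite -Ei -Ej Ey addnA.
  by move: (odd_gt0 om) le_y; rewrite -Ei Ey; clear; lia.
have [p3|np3] := eqVneq p 3.
  subst p; have lt25 := gap 5 3 isT isT erefl isT.
  have c2 : c.+1 < 3 by rewrite -(ltn_exp2l _ _ (isT : 1 < 3)) (leq_trans lt25).
  case: c {adm Ep shift gap lt25} c2 Ei => [//|[|//]] _.
  case: i => [|[|[|[|i]]]] //.
  by rewrite !expnS; clear; lia.
have lt9 : p ^ c.+1 < 3 ^ 2.
  by apply: (gap 3 1) => //; rewrite prime_coprime // dvdn_prime2.
have p9 : p < 9 by apply: leq_trans lt9; rewrite ltnS -{1}(expn1 p) leq_exp2l.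
have c0 : c = 0.
  have p3 : 3 <= p by move: op p1; clear; lia.
  have : p ^ c.+1 < p ^ 2 by rewrite (leq_trans lt9) // leq_exp2r.
  by rewrite ltn_exp2l //; case: c {adm Ep shift gap lt9 Ei}.
subst c.
have [p5|p7] : p = 5 \/ p = 7 by move: op p1 np3 p9; clear; lia.
  by move: Ei; rewrite p5; case: i => [|[|[|i]]] //; rewrite !expnS; clear; lia.
by rewrite p7.
Qed.

(** * The classification *)

Lemma odd_prime_power_split (d : nat) : odd d -> 1 < d -> exists p a r,
  [/\ prime p && odd p, 0 < a, coprime p r, odd r & d = p ^ a * r].
Proof.
move=> od d1.
have pp := pdiv_prime d1; have pd := pdiv_dvd d.
have op := dvdn_odd pd od.
have [r copr dE] := pfactor_coprime pp (ltnW d1).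
exists (pdiv d), (logn (pdiv d) d), r; split=> //.
- by rewrite pp op.
- by rewrite logn_gt0 mem_primes pp (ltnW d1) pd.
- by move: od; rewrite dE oddM => /andP[].
by rewrite mulnC.
Qed.

Lemma admissible_exceptions (d : nat) : odd d -> ~ prime d ->
  ~ (exists p q : nat, [/\ prime p, prime q, p <> q & d = p * q]) ->
  admissible d -> d \in exceptions.
Proof.
move=> od nprime npq adm.
have [d1|d1] := leqP d 1; first by have -> : d = 1 by move: od d1; clear; lia.
have [p [a [r [/andP[pp op] a0 copr or dE]]]] := odd_prime_power_split od d1.
have [r1|r1] := leqP r 1.
  have rE : r = 1 by move: or r1; clear; lia.
  rewrite rE muln1 in dE; subst d.
  apply: admissible_prime_power => //; rewrite ltn_neqAle a0 andbT.
  by apply/eqP => a1; apply: nprime; rewrite -a1 expn1.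
have [q [b [s [/andP[pq oq] b0 coqs os rE]]]] := odd_prime_power_split or r1.
have [copqb cops] : coprime p (q ^ b) /\ coprime p s.
  by apply/andP; rewrite -coprimeMr -rE.
have neq : p != q.
  by move: copqb; rewrite coprime_pexpr // prime_coprime // dvdn_prime2.
rewrite rE mulnA in dE; subst d.
have [s1|s1] := leqP s 1; last first.
  by case: (@three_prime_factors_not_admissible p q a b s).
have sE : s = 1 by move: os s1; clear; lia.
rewrite sE muln1 in od nprime npq adm *.
have nab : ~~ ((a == 1) && (b == 1)).
  apply/negP => /andP[/eqP a1 /eqP b1]; apply: npq.
  by exists p, q; split=> //; [apply/eqP | rewrite a1 b1 !expn1].
have [lt|lt|eqPQ] := ltngtP (p ^ a) (q ^ b).
- by rewrite mulnC in adm *; apply: admissible_two_prime_powers => //; [rewrite eq_sym | rewrite andbC].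
- exact: admissible_two_prime_powers.
by move: copqb; rewrite -eqPQ coprime_pexpr // /coprime gcdnn => /eqP pE; rewrite pE in pp.
Qed.

Theorem theorem1 (d : nat) (d_ge1 : 1 <= d) (d_odd : odd d)
  (d_not_prime : ~ prime d)
  (d_not_pq : ~ exists p q : nat, [/\ prime p, prime q, p <> q & d = p * q]) :
  M_odd d <= 2 <-> d \in [:: 1; 9; 25; 27; 49; 63; 135; 175; 207; 343].
Proof.
split=> [/M_odd_le2P|d_exc].
  exact: admissible_exceptions.
by apply/M_odd_le2P/exceptions_admissible.
Qed.
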